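(* There exists a family of graphs $\{G_n\}_{n\in\mathbb{N}}$ with $|G_n|\to\infty$ for which $$\liminf_{n\rightarrow\infty}\frac{\max_{\mathcal{A}\ \text{full information}}CC_{G_n}(\mathcal{A})}{\vert G_n\vert}>\limsup_{n\rightarrow\infty}\frac{\max_{\mathcal{A}\ \text{blind}}CC_{G_n}(\mathcal{A})}{\vert G_n\vert},$$ i.e. for which an optimal full information algorithm is asymptotically better than an optimal blind algorithm.
   Context: Let $G$ be a fixed graph, with $|G|=m$ vertices. Its vertices become active one by one in a uniformly random order (permutation) $\sigma\in S_m$; $\sigma(i)$ denotes the $i$-th vertex to become active. $CC_G(\sigma,t)$ denotes the number of connected components of the induced subgraph $G[\{\sigma(1),\dots,\sigma(t)\}]$. A full information stopping algorithm on $G$ is a function $\mathcal{A}:S_m\to\{0,1,\dots,m\}$ such that for all $\sigma,\tau\in S_m$: if $\sigma(i)=\tau(i)$ for all $i\le\mathcal{A}(\sigma)$, then $\mathcal{A}(\tau)=\mathcal{A}(\sigma)$. A blind stopping algorithm is one that knows during the game only the number of active vertices, i.e. a constant function $\mathcal{A}\equiv l$ with $l\in\{0,\dots,m\}$. The score of an algorithm is $CC_G(\mathcal{A})=\frac{1}{m!}\sum_{\sigma\in S_m}CC_G(\sigma,\mathcal{A}(\sigma))$. *)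

(* Defs.v *)
(* MathComp / MathComp-Analysis *)
From mathcomp Require Import all_boot all_order all_fingroup all_algebra.
From mathcomp Require Import all_classical all_reals all_analysis.

Set Implicit Arguments.
Unset Strict Implicit.
Unset Printing Implicit Defensive.

Import Order.TTheory GRing.Theory Num.Theory.
Local Open Scope ring_scope.

(* Finite simple graphs.  The vertices are labelled by 'I_(gorder G), so that
   an order of activation is a permutation in 'S_(gorder G). *)
Record graph := Graph {
  gorder : nat;
  adj : rel 'I_gorder;
  adj_sym : symmetric adj;
  adj_irr : irreflexive adj }.

(* Number of connected components of the induced subgraph G[S]: the edges are
   restricted to S, and only the components lying inside S are counted. *)
Definition num_components (G : graph) (S : {set 'I_(gorder G)}) : nat :=
  n_comp [rel x y | [&& x \in S, y \in S & adj x y]] S.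

(* Positions are 0-based: s i is the (i+1)-st vertex to become active. *)
Definition active (G : graph) (s : 'S_(gorder G)) (t : nat) :
    {set 'I_(gorder G)} :=
  [set s i | i : 'I_(gorder G) & (i < t)%N].

Definition CC (G : graph) (s : 'S_(gorder G)) (t : nat) : nat :=
  num_components (active s t).

(* 'I_(gorder G).+1 is the set of possible stopping times {0, ..., |G|}. *)
Definition algorithm (G : graph) : finType :=
  {ffun 'S_(gorder G) -> 'I_(gorder G).+1}.

Definition full_information (G : graph) (A : algorithm G) : bool :=
  [forall s : 'S_(gorder G), forall t : 'S_(gorder G),
    [forall i : 'I_(gorder G), (i < A s)%N ==> (s i == t i)] ==> (A t == A s)].

Definition blind (G : graph) (A : algorithm G) : bool :=
  [exists l : 'I_(gorder G).+1, A == [ffun=> l]].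

Definition score (R : realType) (G : graph) (A : algorithm G) : R :=
  ((gorder G)`!%:R)^-1 * \sum_(s : 'S_(gorder G)) (CC s (A s))%:R.

(* Scores are nonnegative, so the default value 0 does not affect the maximum
   over a nonempty class P; full_information and blind are nonempty, as both
   contain the constant algorithms. *)
Definition max_score (R : realType) (G : graph) (P : pred (algorithm G)) : R :=
  \big[Num.max/0]_(A : algorithm G | P A) score R A.

(* Main.v *)
(** Let G_k consist of a star with 2k leaves and 2k isolated vertices.  When a
    proportion x of the vertices is active, the expected number of components is
    about (x/2 + x(1-x)/2) |G_k|, which is at most |G_k|/2 + o(|G_k|), attained at
    x = 1.  A full information player waits until x = 3/4: if the hub is still
    inactive, all active vertices are components and it stops; otherwise the
    isolated vertices are the only remaining gain and it plays to the end.  This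
    yields (3/4)(1/2) + (1/4)(3/4) = 9/16 of |G_k|.  The lower-order terms are
    absorbed by taking k >= 10 and the weaker constants 33/64 < 17/32. *)

Require Import Defs.
From mathcomp Require Import all_boot all_order all_fingroup all_algebra.
From mathcomp Require Import all_classical all_reals all_analysis.
From mathcomp Require Import zify ring lra.

Import Order.TTheory GRing.Theory Num.Theory.

(** * Counting the orders in which given vertices are active at a fixed time *)

Section ActiveSets.
Variable G : graph.
Local Notation V := 'I_(gorder G).
Implicit Types (s : 'S_(gorder G)) (t : nat) (u v h : V).

Lemma mem_active s t u : (u \in active s t) = ((s^-1)%g u < t)%N.
Proof.
apply/imsetP/idP => [[i /[!inE] it ->]|ut]; first by rewrite permK.
by exists ((s^-1)%g u); rewrite ?inE ?permKV.
Qed.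

Lemma card_active s t : (t <= gorder G)%N -> #|active s t| = t.
Proof.
move=> tm; rewrite card_imset; last exact: perm_inj.
rewrite -sum1_card (eq_bigl (fun i : V => (i < t)%N)); last first.
  by move=> i; rewrite inE.
by rewrite (big_ord_narrow tm) sum1_card card_ord.
Qed.

Lemma active_full s : active s (gorder G) = [set: V].
Proof. by apply/setP => u; rewrite mem_active inE ltn_ord. Qed.

Lemma mem_active_mul s (p : 'S_(gorder G)) t u :
  (p u \in active (s * p)%g t) = (u \in active s t).
Proof. by rewrite !mem_active invMg permM permK. Qed.

(** Uniform orders are exchangeable: right multiplication by [p] permutes the orders and relabels
    the active set by [p]. *)
Lemma sum_active_reindex (p : 'S_(gorder G)) t (F : pred V -> nat) :
  \sum_s F [pred u | p u \in active s t] = \sum_s F [pred u | u \in active s t].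
Proof.
rewrite (reindex_inj (mulIg p)); apply: eq_bigr => s _; congr F.
by apply/funext => u /=; rewrite mem_active_mul.
Qed.

(** The probability t/m, with denominators cleared: by symmetry every vertex is active in equally
    many orders, and each order has [t] active vertices. *)
Lemma sum_mem_active t u : (t <= gorder G)%N ->
  (gorder G * \sum_s (u \in active s t) = (gorder G)`! * t)%N.
Proof.
move=> tm.
have sym v : \sum_s (v \in active s t) = \sum_s (u \in active s t).
  rewrite -(sum_active_reindex (tperm u v) t (fun S => nat_of_bool (S u))).
  by rewrite /= tpermL.
have <- : (\sum_(v : V) \sum_s (v \in active s t) = (gorder G)`! * t)%N.
  rewrite exchange_big (eq_bigr (fun=> t)) => [|s _].
    by rewrite sum_nat_const card_Sn.
  rewrite -[RHS](card_active s t tm) -sum1_card [RHS]big_mkcond.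
  by apply: eq_bigr => v _; case: (v \in _).
by rewrite (eq_bigr _ (fun v _ => sym v)) sum_nat_const card_ord.
Qed.

Lemma sum_notin_active t h : (t <= gorder G)%N ->
  (gorder G * \sum_s (h \notin active s t) = (gorder G)`! * (gorder G - t))%N.
Proof.
move=> tm; have := sum_mem_active t h tm.
have : (\sum_s (h \in active s t) + \sum_s (h \notin active s t) = (gorder G)`!)%N.
  rewrite -big_split -[RHS]muln1 -card_Sn -sum_nat_const.
  by apply: eq_bigr => s _ /=; case: (h \in _).
move: (\sum_s _)%N (\sum_s _)%N => a b <-; nia.
Qed.

(** In each order that leaves [h] inactive, the [t] active vertices lie among the m-1 others;
    transpositions fixing [h] show that these are active equally often. *)
Lemma sum_mem_notin_active t u h : (t <= gorder G)%N -> u != h ->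
  (gorder G * (gorder G).-1 *
     \sum_s ((u \in active s t) && (h \notin active s t))
   = (gorder G)`! * (t * (gorder G - t)))%N.
Proof.
move=> tm uh.
have sym v : v != h ->
    \sum_s ((v \in active s t) && (h \notin active s t))
  = \sum_s ((u \in active s t) && (h \notin active s t)).
  move=> vh; rewrite -(sum_active_reindex (tperm u v) t
    (fun S => nat_of_bool (S u && ~~ S h))) /= tpermL tpermD //.
rewrite [RHS]mulnCA -(sum_notin_active t h tm) [RHS]mulnCA -mulnA; congr (_ * _)%N.
have <- : (\sum_(v : V | v != h) \sum_s ((v \in active s t) && (h \notin active s t))
   = t * \sum_s (h \notin active s t))%N.
  rewrite exchange_big big_distrr; apply: eq_bigr => s _ /=.
  have [hs|hs] := boolP (h \in active s t).
    by rewrite muln0 big1 // => v _; rewrite andbF.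
  rewrite muln1 -{2}(card_active s t tm) -sum1_card big_mkcond [RHS]big_mkcond.
  apply: eq_bigr => v _; rewrite andbT.
  by case: eqVneq => [->|_] /=; [rewrite (negPf hs)|case: (v \in _)].
rewrite (eq_bigr _ sym) sum_nat_const; congr (_ * _)%N.
by have := cardC1 h; rewrite card_ord => <-; apply: eq_card => v; rewrite !inE.
Qed.

End ActiveSets.

(** * Bounds on the number of components, counted by their canonical roots *)

Section Components.
Variables (G : graph) (S : {set 'I_(gorder G)}).
Local Notation e := [rel x y | [&& x \in S, y \in S & @adj G x y]].

Lemma induced_connect_sym : connect_sym e.
Proof. by apply: sym_connect_sym => x y /=; rewrite adj_sym andbCA. Qed.

(** A path from a vertex of [I] to its root cannot take a first step, so the vertex is its own
    root. *)
Lemma isolated_leq_num_components (I : {set 'I_(gorder G)}) :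
  I \subset S -> {in I & S, forall x y, ~~ adj x y} ->
  (#|I| <= num_components S)%N.
Proof.
move=> IS isoI; apply: subset_leq_card; apply/fintype.subsetP => x xI.
have xS := fintype.subsetP IS x xI; rewrite inE /= xS andbT /roots.
have /connectP[[|y p] /= + ->] := connect_root e x; first by [].
by case/andP => /and3P[_ yS xy]; have := isoI x y xI yS; rewrite xy.
Qed.

Lemma num_components_leq_card : (num_components S <= #|S|)%N.
Proof. by apply: subset_leq_card; apply/fintype.subsetP => x; rewrite inE => /andP[]. Qed.

(** A neighbour of [h] in [S] shares the root of [h], so all these neighbours and [h] itself account
    for one root. *)
Lemma num_components_hub (h : 'I_(gorder G)) : h \in S ->
  (num_components S <= #|[set x in S | (x != h) && ~~ adj h x]|.+1)%N.
Proof.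
move=> hS; rewrite -add1n -(cards1 (fingraph.root e h)).
apply: leq_trans (leq_card_setU _ _); apply: subset_leq_card.
apply/fintype.subsetP => x; rewrite !inE /= => /andP[/eqP xr xS].
rewrite xS /=; have [xh|xh] /= := eqVneq x h.
  by rewrite -{1}xr xh eqxx.
have [hx|] := boolP (adj h x); last by rewrite orbT.
rewrite orbF -{1}xr; apply/eqP; apply/(fingraph.rootP induced_connect_sym).
by rewrite induced_connect_sym connect1 //= hS xS.
Qed.

End Components.

(** * The algorithm that decides at time [T] by looking at one vertex *)

Section WaitingAlgorithm.
Variables (G : graph) (h : 'I_(gorder G)) (T : nat).
Hypothesis Tm : (T <= gorder G)%N.

Definition waiting_algorithm : algorithm G :=
  [ffun s => if h \in active s T then ord_max else inord T].

Lemma waiting_algorithmE (s : 'S_(gorder G)) :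
  nat_of_ord (waiting_algorithm s) = if h \in active s T then gorder G else T.
Proof. by rewrite ffunE; case: ifP => // _; rewrite inordK. Qed.

(** If it plays to the end, agreement means equal orders; if it stops at [T], agreement up to [T]
    fixes the active set that the decision depends on. *)
Lemma waiting_algorithm_full_information : full_information waiting_algorithm.
Proof.
apply/'forall_forallP => s t; apply/implyP => /forallP agree.
apply/eqP/val_inj => /=; move: agree; rewrite !waiting_algorithmE.
case: ifPn => hs agree.
  suff -> : t = s by rewrite hs.
  by apply/permP => i; have /implyP/(_ (ltn_ord i))/eqP := agree i.
suff -> : active t T = active s T by rewrite (negPf hs).
apply/eq_in_imset => i; rewrite inE => iT.
by have /implyP/(_ iT)/eqP := agree i.
Qed.

End WaitingAlgorithm.

(** * The star with isolated vertices *)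

Section StarPlusIsolated.
Variable k : nat.
Local Notation V := 'I_(4 * k).+1.

(** Vertex 0 is the hub, 1 to 2k are the leaves, and the labels above 2k are isolated. *)
Definition star_adj : rel V :=
  [rel x y | (x == ord0) && (0 < y <= 2 * k)%N
          || (y == ord0) && (0 < x <= 2 * k)%N].

Lemma star_adj_sym : symmetric star_adj.
Proof. by move=> x y; rewrite /star_adj /= orbC. Qed.

Lemma star_adj_irr : irreflexive star_adj.
Proof. by move=> x; rewrite /star_adj /= orbb; case: eqP => // ->. Qed.

Definition star_graph : graph := Graph star_adj_sym star_adj_irr.

Lemma card_isolated : #|[set x : V | (2 * k < x)%N]| = (2 * k)%N.
Proof.
have -> : [set x : V | (2 * k < x)%N] = ~: [set x : V | (x < (2 * k).+1)%N].
  by apply/setP => x; rewrite !inE -leqNgt.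
have le : ((2 * k).+1 <= (4 * k).+1)%N by lia.
have := cardsC [set x : V | (x < (2 * k).+1)%N]; rewrite card_ord.
have -> : #|[set x : V | (x < (2 * k).+1)%N]| = (2 * k).+1.
  rewrite -sum1_card (eq_bigl (fun i : V => (i < (2 * k).+1)%N)); last first.
  by move=> i; rewrite inE.
  by rewrite (big_ord_narrow le) sum1_card card_ord.
lia.
Qed.

Lemma card_leaves : #|[set x : V | (0 < x <= 2 * k)%N]| = (2 * k)%N.
Proof.
have le : ((2 * k).+1 <= (4 * k).+1)%N by lia.
rewrite -sum1_card (eq_bigl (fun i : V => (0 < i)%N && (i < (2 * k).+1)%N)); last first.
  by move=> i; rewrite inE.
rewrite (big_ord_narrow_cond le) sum1_card /=.
have := cardC1 (ord0 : 'I_(2 * k).+1); rewrite card_ord /= => E; rewrite -[RHS]E.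
by apply: eq_card => -[[|i] lt_i]; rewrite !inE -topredE.
Qed.

Implicit Types (s : 'S_(gorder star_graph)) (t : nat).
Local Notation hub := (ord0 : V).

(** An active hub merges all active leaves into its own component, the last term; leaves count
    separately only while the hub is inactive. *)
Lemma star_CC_upper s t :
  (CC s t <= \sum_(u : V | (2 * k < u)%N) (u \in active s t)
           + \sum_(u : V | (0 < u <= 2 * k)%N)
               ((u \in active s t) && (hub \notin active s t))
           + (hub \in active s t))%N.
Proof.
have cardE (P : pred V) : (\sum_(u | P u) (u \in active s t))%N
    = #|[set u in active s t | P u]|.
  rewrite -sum1_card big_mkcond [RHS]big_mkcond; apply: eq_bigr => u _.
  by rewrite inE; case: (P u); case: (u \in _).
have [hs|hs] := boolP (hub \in active s t).
  rewrite [X in (_ + X + _)%N]big1 => [|u _]; last by rewrite andbF.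
  rewrite addn0 addn1 cardE; apply: leq_trans (num_components_hub _ _ _ hs) _.
  rewrite ltnS; apply: subset_leq_card; apply/fintype.subsetP => u.
  rewrite !inE /= => /and3P[-> u0 /=].
  move: u0; rewrite -(inj_eq val_inj) /= -lt0n => u0.
  by rewrite /star_adj /= u0 negb_or -ltnNge => /andP[].
rewrite addn0; under [X in (_ + X)%N]eq_bigr do rewrite andbT.
apply: leq_trans (num_components_leq_card _ _) _.
rewrite !cardE; apply: leq_trans (leq_card_setU _ _).
apply: subset_leq_card; apply/fintype.subsetP => u us; rewrite !inE us /=.
case: (posnP u) => [u0|]; last by lia.
by move: hs us => /negP hs us; case: hs; rewrite -(_ : u = hub) //; apply/val_inj.
Qed.

Lemma star_CC_full s : (2 * k <= CC s (gorder star_graph))%N.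
Proof.
rewrite -card_isolated; apply: isolated_leq_num_components.
  by rewrite active_full; apply/fintype.subsetP.
move=> x y; rewrite inE => xk _; rewrite /= /star_adj /= -(inj_eq val_inj) /=.
by rewrite [(x <= _)%N]leqNgt xk !andbF orbF negb_and -lt0n (leq_ltn_trans _ xk).
Qed.

(** Every edge contains the hub, so without it the active set is independent. *)
Lemma star_CC_independent s t : (t <= gorder star_graph)%N ->
  hub \notin active s t -> (t <= CC s t)%N.
Proof.
move=> tm hs; rewrite -{1}(card_active _ s t tm).
apply: isolated_leq_num_components => // x y xs ys /=.
by apply/negP => /orP[] /andP[/eqP E _]; move: hs; rewrite -E ?xs ?ys.
Qed.

(** Linearity of expectation applied to [star_CC_upper], multiplied by m(m-1) for m = 4k+1. *)
Lemma star_sum_CC_upper t : (t <= (4 * k).+1)%N ->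
  ((4 * k).+1 * (4 * k) * \sum_(s : 'S_(gorder star_graph)) CC s t
   <= (4 * k).+1`! * (2 * k * (t * (4 * k)) + 2 * k * (t * ((4 * k).+1 - t)) + t * (4 * k)))%N.
Proof.
move=> tm; have M u := @sum_mem_active star_graph t u tm.
have N u v := @sum_mem_notin_active star_graph t u v tm.
rewrite /= in M N.
have bound := leq_sum (index_enum _) (fun s (_ : true) => star_CC_upper s t).
apply: leq_trans (leq_mul (leqnn _) bound) _.
rewrite !big_split /= exchange_big [X in (_ * (_ + X + _) <= _)%N]exchange_big /=.
set a := \sum_(i | _) _; set b := \sum_(i | _) _; set c := \sum_i _.
have Ea : ((4 * k).+1 * a = 2 * k * ((4 * k).+1`! * t))%N.
  rewrite /a big_distrr /= (eq_bigr _ (fun u _ => M u)) sum_nat_const.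
  by have := card_isolated; rewrite cardsE => ->.
have Eb : ((4 * k).+1 * (4 * k) * b
           = 2 * k * ((4 * k).+1`! * (t * ((4 * k).+1 - t))))%N.
  rewrite /b big_distrr /=; under eq_bigr => u /andP[u0 _].
    rewrite N; last by apply: contraTneq u0 => ->.
    over.
  by rewrite sum_nat_const; have := card_leaves; rewrite cardsE => ->.
have Ec : ((4 * k).+1 * c = (4 * k).+1`! * t)%N by exact: M.
apply/eq_leq; transitivity
  (4 * k * ((4 * k).+1 * a) + (4 * k).+1 * (4 * k) * b + 4 * k * ((4 * k).+1 * c))%N.
  by ring.
by rewrite Ea Eb Ec; ring.
Qed.

(** Orders with the hub active at time [t] contribute at least 2k each, the others at least [t]. *)
Lemma star_sum_CC_waiting_lower t : (t <= (4 * k).+1)%N ->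
  ((4 * k).+1`! * (t * (2 * k) + ((4 * k).+1 - t) * t) <=
   (4 * k).+1 * \sum_(s : 'S_(gorder star_graph))
     CC s (waiting_algorithm star_graph hub t s))%N.
Proof.
move=> tm; have M := @sum_mem_active star_graph t hub tm.
have N := @sum_notin_active star_graph t hub tm.
rewrite mulnDr !mulnA -{}M -{}N -!mulnA -mulnDr !big_distrl -big_split.
rewrite leq_mul2l; apply/orP; right; apply: leq_sum => s _.
rewrite waiting_algorithmE //; have [hs|hs] := boolP (_ \in _).
  by rewrite /= mul1n mul0n addn0 star_CC_full.
by rewrite /= mul0n mul1n star_CC_independent.
Qed.

(** * Numerical bounds on the best blind and full information scores *)

Local Open Scope ring_scope.

Lemma star_max_blind (R : realType) : (9 < k)%N ->
  max_score R (@blind star_graph) / (4 * k).+1%:R <= 33 / 64.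
Proof.
move=> k9; have m0 : 0 < (4 * k).+1%:R :> R by [].
rewrite ler_pdivrMr //; apply: bigmax_le => [|A /existsP[l /eqP ->]].
  (* The default value 0 of the maximum must obey the bound too. *)
  by rewrite mulr_ge0.
rewrite /score; under eq_bigr do rewrite ffunE.
have tm : (l <= (4 * k).+1)%N := ltn_ord l.
have F0 : 0 < (4 * k).+1`!%:R :> R by rewrite ltr0n fact_gt0.
rewrite /= -natr_sum [leLHS]mulrC ler_pdivrMr //.
have := star_sum_CC_upper l tm.
have K10 : 10 <= k%:R :> R by rewrite ler_nat.
have mE : (4 * k).+1%:R = 4 * k%:R + 1 :> R by rewrite -natr1 natrM.
move: F0; move: (\sum_s _)%N (_`!)%N => S f F0.
rewrite -(ler_nat R) !natrM !natrD !natrM natrB //.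
move: tm m0; rewrite -(ler_nat R) mE.
move: (k%:R) (l%:R) (S%:R) (f%:R) F0 K10 => K x C F F0 K10 xm m0 bound.
have K0 : 0 < (4 * K + 1) * (4 * K) by rewrite mulr_gt0 //; lra.
rewrite -(ler_pM2l K0); apply: le_trans bound _.
(* With m = 4K+1 the left side is x(2m+1-x), at most m(m+1) for x <= m; since m >= 41, the extra m
   is below m^2/32. *)
have key : 4 * K * x + x * (4 * K + 1 - x) + 2 * x <= 33 / 32 * (4 * K + 1) ^+ 2.
  by nra.
have -> : (4 * K + 1) * (4 * K) * (33 / 64 * (4 * K + 1) * F)
  = F * (2 * K * (33 / 32 * (4 * K + 1) ^+ 2)) by field.
rewrite ler_pM2l //; nra.
Qed.

Lemma star_max_full (R : realType) : (9 < k)%N ->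
  17 / 32 <= max_score R (@full_information star_graph) / (4 * k).+1%:R.
Proof.
move=> k9; have m0 : 0 < (4 * k).+1%:R :> R by [].
(* The decision time 3k is about three quarters of the order. *)
have tm : (3 * k <= (4 * k).+1)%N by lia.
rewrite ler_pdivlMr //; apply: bigmax_sup.
  exact: (waiting_algorithm_full_information star_graph hub _ tm).
have F0 : 0 < (4 * k).+1`!%:R :> R by rewrite ltr0n fact_gt0.
rewrite /score /= -natr_sum [leRHS]mulrC ler_pdivlMr //.
have := star_sum_CC_waiting_lower _ tm.
have K10 : 10 <= k%:R :> R by rewrite ler_nat.
have mE : (4 * k).+1%:R = 4 * k%:R + 1 :> R by rewrite -natr1 natrM.
move: F0; move: (\sum_s _)%N (_`!)%N => S f F0.
rewrite -(ler_nat R) !natrM !natrD !natrM natrB // !natrM.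
move: m0; rewrite mE.
move: (k%:R) (S%:R) (f%:R) F0 K10 => K C F F0 K10 m0 bound.
rewrite -(ler_pM2l m0); apply: le_trans bound.
have -> : (4 * K + 1) * (17 / 32 * (4 * K + 1) * F)
  = F * (17 / 32 * (4 * K + 1) ^+ 2) by field.
(* At time 3K the lower bound is 9K^2 + 3K, to be compared with 17/2 K^2 + 17/4 K + 17/32. *)
rewrite ler_pM2l //; nra.
Qed.

End StarPlusIsolated.

(** * Passage to the limit *)

Lemma limn_esup_le (R : realType) (u : (\bar R)^nat) (l : \bar R) :
  (forall n, (u n <= l)%E) -> (limn_esup u <= l)%E.
Proof.
move=> ul; rewrite /limn_esup limf_esupE; apply: ereal_inf_le.
(* The bound holds at every index, so the supremum over the whole sequence already serves. *)
exists (ereal_sup [set u x | x in [set: nat]]).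
  by exists setT => //; exact: filterT.
by apply: ge_ereal_sup => _ [x _ <-].
Qed.

Lemma limn_einf_ge (R : realType) (u : (\bar R)^nat) (l : \bar R) :
  (forall n, (l <= u n)%E) -> (l <= limn_einf u)%E.
Proof.
move=> lu; rewrite leeNr; apply: limn_esup_le => n.
by rewrite leeN2.
Qed.

Local Open Scope classical_set_scope.
Local Open Scope ring_scope.

Theorem mainTheorem5 (R : realType) :
  exists G : nat -> graph,
    (gorder (G n) @[n --> \oo] --> \oo) /\
    (limn_esup (fun n =>
       (max_score R (@blind (G n)) / (gorder (G n))%:R)%:E)
     < limn_einf (fun n =>
       (max_score R (@full_information (G n)) / (gorder (G n))%:R)%:E))%E.
Proof.
(* The shift by 10 makes both score bounds valid at every index, including 0. *)
exists (fun n => star_graph (n + 10)); split.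
  by apply/cvgnyPge => A; exists A => // n /= An; lia.
apply: (@le_lt_trans _ _ (33 / 64)%:E).
  by apply: limn_esup_le => n; rewrite lee_fin star_max_blind // ; lia.
apply: (@lt_le_trans _ _ (17 / 32)%:E); first by rewrite lte_fin; lra.
by apply: limn_einf_ge => n; rewrite lee_fin star_max_full //; lia.
Qed.
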